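(* In the identification game with a three-dimensional random variable ($d=3$, values $x_1,x_2,x_3$) and sets $S_1=\{x_1,x_2\}$, $S_2=\{x_2,x_3\}$, $S_3=\{x_3,x_1\}$ ($n=2$), there exists no (deterministic) strategy by which Alice and Bob win the game when Alice is allowed to send only one classical bit to Bob. That is, there is no encoding $e:\{x_1,x_2,x_3\}\to\{0,1\}$ together with decoding maps $D_j:\{0,1\}\to S_j\cup\{?\}$, $j=1,2,3$, such that $D_j(e(x_i))=x_i$ for every $j\in\{1,2,3\}$ and every $x_i\in S_j$.
   Context: The game: a Referee sends Alice a value $x_i$ of a random variable $X$ with values $\{x_1,x_2,x_3\}$ (equally probable) and simultaneously sends Bob an index $j\in\{1,2,3\}$ such that $x_i\in S_j$. Alice does not know $j$; Bob does not know $x_i$ (only that $x_i\in S_j$). The value set and the sets $S_j$ are known to both. Alice sends Bob one message, and Bob then outputs either an element of $S_j$ or ''inconclusive'' ($?$). The encoding-decoding strategy is fixed before the game begins. Only deterministic strategies are allowed: no local or shared randomness or other correlations. With a classical bit (cbit), Alice's message is a function $e(x_i)\in\{0,1\}$ and Bob's output is a function $D_j$ of the received bit, depending on $j$. The game is won if and only if, for every $j$ and every $x_i\in S_j$, Bob identifies $x_i$ unambiguously, i.e. he never outputs a wrong value and outputs the right value with nonzero probability. For deterministic classical strategies this means $D_j(e(x_i))=x_i$. *)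

(* Defs.v *)
From mathcomp Require Import all_boot.

Set Implicit Arguments.
Unset Strict Implicit.
Unset Printing Implicit Defensive.

(* A deterministic strategy for the identification game with value set [X] and
   question sets [S j], when Alice may send one message from the alphabet [M]
   ([bool] for one classical bit). Her message depends on the value only; Bob's
   output depends on [j] and the message only. The output [None] stands for
   "inconclusive", [Some y] for the element [y] of [S j]. *)
Record strategy (X J : finType) (S : J -> {set X}) (M : Type) := Strategy {
  encode : X -> M;
  decode : forall j : J, M -> option {y : X | y \in S j}
}.

(* Unambiguous identification. Under a deterministic strategy each output has
   probability 0 or 1, so "never a wrong value, and the right value with nonzero
   probability" says that Bob's output is the value Alice received. The
   probabilities of the values play no role. *)
Definition wins (X J : finType) (S : J -> {set X}) (M : Type)
    (s : strategy S M) : Prop :=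
  forall (j : J) (y : {y : X | y \in S j}), decode s j (encode s (val y)) = Some y.

(* With indices 0, 1, 2 for 1, 2, 3 and [ordS] the cyclic successor, these are
   S_1 = {x_1, x_2}, S_2 = {x_2, x_3} and S_3 = {x_3, x_1}. *)
Definition cyclic_pairs (X : finType) (x : 'I_3 -> X) (j : 'I_3) : {set X} :=
  [set x j; x (ordS j)].

(* Main.v *)
(* Two values lying in a common set [S j] must get distinct messages, since Bob
   tells them apart from the message alone. Any two of the three values share a
   set, so Alice's encoding would inject three values into two messages. *)
Require Import Defs.
From mathcomp Require Import all_boot.

Lemma wins_encode_inj (X J : finType) (S : J -> {set X}) (M : Type)
    (s : strategy S M) (j : J) :
  wins s -> {in S j &, injective (encode s)}.
Proof.
move=> win y z Sy Sz eq_yz.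
(* Bob's decoder for [j] sees one and the same message for [y] and [z], so its single output must be
   both. *)
have := win j (exist _ y Sy); rewrite /= eq_yz.
by rewrite (win j (exist _ z Sz)) => -[].
Qed.

(** On a cycle of length 3, two indices are either equal or adjacent, and the pair starting at the
    earlier of two adjacent indices contains both values. *)
Lemma cyclic_pairs_cover (X : finType) (x : 'I_3 -> X) (i k : 'I_3) :
  exists j, (x i \in cyclic_pairs x j) && (x k \in cyclic_pairs x j).
Proof.
have : [|| k == i, k == ordS i | i == ordS k].
  by case: i k => [[|[|[|i]]] lt_i3] [[|[|[|k]]] lt_k3].
case/or3P=> /eqP->; [exists i | exists i | exists k];
  by rewrite !inE !eqxx ?orbT.
Qed.

Theorem proposition1 (X : finType) (x : 'I_3 -> X) (x_bij : bijective x) :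
  ~ exists s : strategy (cyclic_pairs x) bool, wins s.
Proof.
case=> s win.
(* Composing with [x] moves the count to ['I_3], where injectivity into [bool] would give 3 <= 2. *)
have ex_inj : injective (encode s \o x).
  move=> i k eq_ik; apply: (bij_inj x_bij).
  have [j /andP[xi xk]] := cyclic_pairs_cover X x i k.
  exact: (wins_encode_inj _ _ _ _ s j win _ _ xi xk eq_ik).
by have := leq_card _ ex_inj; rewrite card_ord card_bool.
Qed.
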